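(* The Mossay-Tabuchi stability index of $\Phi^{K_{n,m}}$ is equal to $$\left(\sqrt{(m-1)(n-1)}\right)^{-1}.$$ If $n,m\ge 2$ and $n+m\ge 5$, then $\Phi^{K_{n,m}}$ is not Mossay-Tabuchi stable.
   Context: A real $N\times N$ matrix $\Phi=(\phi_{ij})_{1\le i,j\le N}$ is a freeness-of-trade matrix if for all $i,j,k$: (1) $0<\phi_{ij}\le 1$; (2) $\phi_{ij}\phi_{jk}\le \phi_{ik}$; (3) $\phi_{ij}=\phi_{ji}$; (4) $\phi_{ii}=1$. The friction-of-trade (pseudo-)metric of $\Phi$ is $M_\Phi=(m_{ij})$ with $m_{ij}=-\log\phi_{ij}$; conversely a (pseudo-)metric $(m_{ij})$ on $\{1,\dots,N\}$ corresponds to the freeness-of-trade matrix $\phi_{ij}=e^{-m_{ij}}$. For $0<t\le 1$ set $\Phi_t=(\phi_{ij}^{-\log t})_{1\le i,j\le N}$, equivalently $\Phi_t=(t^{m_{ij}})_{1\le i,j\le N}$; for $t=0$, $\Phi_0$ is understood as the limit as $t\to 0^+$ (the identity matrix when $M_\Phi$ is a genuine metric). $\Phi$ is Mossay-Tabuchi stable if $\Phi_t$ is positive semi-definite for all $0<t<1$. The Mossay-Tabuchi (stability) index of $\Phi$ is the largest $t_0\in[0,1]$ such that $\Phi_t$ is positive semi-definite for all $0\le t\le t_0$; Mossay-Tabuchi stability is equivalent to having index $1$. For positive integers $n,m$, the $K_{n,m}$ bipartite metric on the $n+m$ points $\{1,\dots,n+m\}$ is the shortest-path metric of the complete bipartite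 graph with parts $\{1,\dots,n\}$ and $\{n+1,\dots,n+m\}$: $m_{ii}=0$; $m_{ij}=1$ if $i$ and $j$ lie in different parts; and $m_{ij}=2$ if $i\ne j$ lie in the same part. $\Phi^{K_{n,m}}$ denotes the corresponding freeness-of-trade matrix, so that $\Phi^{K_{n,m}}_t=(t^{m_{ij}})$.
   Formalization: When n = 1 or m = 1 the formula divides by zero; the formula is therefore asserted for n, m ≥ 2, and in the remaining cases the index is stated to be 1. *)

(* Defs.v *)
From mathcomp Require Import all_boot all_order all_algebra.
From mathcomp Require Import all_classical all_reals all_analysis.

Set Implicit Arguments.
Unset Strict Implicit.
Unset Printing Implicit Defensive.

Import Order.TTheory GRing.Theory Num.Theory.
Import numFieldNormedType.Exports.

Local Open Scope classical_set_scope.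
Local Open Scope ring_scope.

Definition psdmx (R : realType) (N : nat) (A : 'M[R]_N) : Prop :=
  A^T = A /\ forall v : 'rV[R]_N, 0 <= (v *m A *m v^T) 0 0.

Record is_freeness (R : realType) (N : nat) (Phi : 'M[R]_N) : Prop := {
  freeness_bounds : forall i j, 0 < Phi i j <= 1;
  freeness_triangle : forall i j k, Phi i j * Phi j k <= Phi i k;
  freeness_sym : forall i j, Phi i j = Phi j i;
  freeness_diag : forall i, Phi i i = 1 }.

Record freeness (R : realType) (N : nat) := Freeness {
  freeness_mx :> 'M[R]_N;
  freenessP : is_freeness freeness_mx }.

Record is_pseudometric (R : realType) (N : nat) (M : 'M[R]_N) : Prop := {
  pseudometric_ge0 : forall i j, 0 <= M i j;
  pseudometric_diag : forall i, M i i = 0;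
  pseudometric_sym : forall i j, M i j = M j i;
  pseudometric_triangle : forall i j k, M i k <= M i j + M j k }.

Lemma expR_metric_is_freeness (R : realType) (N : nat) (M : 'M[R]_N) :
  is_pseudometric M -> is_freeness (\matrix_(i, j) expR (- M i j)).
Proof.
move=> [M0 Md Ms Mt]; split=> [i j|i j k|i j|i]; rewrite !mxE.
- by rewrite expR_gt0 -expR0 ler_expR oppr_le0 M0.
- by rewrite -expRD ler_expR -opprD lerN2.
- by rewrite Ms.
- by rewrite Md oppr0 expR0.
Qed.

Definition freeness_of_metric (R : realType) (N : nat) (M : 'M[R]_N)
    (hM : is_pseudometric M) : freeness R N :=
  Freeness (expR_metric_is_freeness hM).

(* For t > 0 this is (phi_ij ^ (- log t)); at t = 0 it is the entrywise limit
   as t -> 0+. *)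
Definition freeness_at (R : realType) (N : nat) (Phi : freeness R N) (t : R) :
    'M[R]_N :=
  if t == 0 then \matrix_(i, j) lim (Phi i j `^ (- ln s) @[s --> 0^'+])
  else \matrix_(i, j) (Phi i j `^ (- ln t)).

Definition MT_stable (R : realType) (N : nat) (Phi : freeness R N) : Prop :=
  forall t : R, 0 < t < 1 -> psdmx (freeness_at Phi t).

Definition MT_admissible (R : realType) (N : nat) (Phi : freeness R N) : set R :=
  [set t0 | 0 <= t0 <= 1 /\
            forall t : R, 0 <= t <= t0 -> psdmx (freeness_at Phi t)].

Definition is_MT_index (R : realType) (N : nat) (Phi : freeness R N) (t0 : R) :
    Prop :=
  MT_admissible Phi t0 /\ ubound (MT_admissible Phi) t0.

(* The vertices of K_{n,m} are 'I_(n + m), with parts {i | i < n} and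
   {i | n <= i}. *)
Definition K_edge (n m : nat) : rel 'I_(n + m) :=
  fun i j => (i < n)%N != (j < n)%N.

Definition K_dist (n m : nat) (i j : 'I_(n + m)) : nat :=
  if i == j then 0%N else if K_edge i j then 1%N else 2%N.

(* K_dist is the shortest-path distance of the complete bipartite graph. *)
Lemma K_dist_shortest_path (n m : nat) (hn : (0 < n)%N) (hm : (0 < m)%N)
    (i j : 'I_(n + m)) :
  (exists p, [/\ path (@K_edge n m) i p, last i p = j & size p = K_dist i j]) /\
  (forall p, path (@K_edge n m) i p -> last i p = j -> (K_dist i j <= size p)%N).
Proof.
rewrite /K_dist; split.
  case: eqVneq => [<-|ij]; first by exists [::].
  case: ifPn => eij; first by exists [:: j]; rewrite /= eij.
  have l0 : (0 < n + m)%N by rewrite addn_gt0 hn.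
  have ln : (n < n + m)%N by rewrite -[ltnLHS]addn0 ltn_add2l.
  exists [:: if (i < n)%N then Ordinal ln else Ordinal l0; j].
  split=> //=; move: eij; rewrite /K_edge negbK => /eqP eij.
  by rewrite -eij; case: (i < n)%N; rewrite /= ?ltnn ?hn.
case=> [|x [|y p]] /=; first by move=> _ ->; rewrite eqxx.
  by rewrite andbT => eix <-; rewrite eix; case: eqP.
by move=> _ _; case: ifP => // _; case: ifP.
Qed.

Definition K_metric (R : realType) (n m : nat) : 'M[R]_(n + m) :=
  \matrix_(i, j) (K_dist i j)%:R.

Lemma K_metric_is_pseudometric (R : realType) (n m : nat) :
  is_pseudometric (K_metric R n m).
Proof.
split=> [i j|i|i j|i j k]; rewrite !mxE.
- exact: ler0n.
- by rewrite /K_dist eqxx.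
- by rewrite /K_dist /K_edge (eq_sym j i) (eq_sym (j < n)%N).
rewrite -natrD ler_nat /K_dist /K_edge.
case: (eqVneq i j) => [->|ij]; first by rewrite add0n.
case: (eqVneq j k) => [<-|jk]; first by rewrite (negPf ij) addn0.
case: (i == k) => //; case: (i < n)%N; case: (j < n)%N; case: (k < n)%N => //.
Qed.

Definition K_freeness (R : realType) (n m : nat) : freeness R (n + m) :=
  freeness_of_metric (K_metric_is_pseudometric R n m).

(* Main.v *)
Require Import Defs.
From mathcomp Require Import all_boot all_order all_algebra.
From mathcomp Require Import all_classical all_reals all_analysis.
From mathcomp Require Import ring lra.

Import Order.TTheory GRing.Theory Num.Theory.
Import numFieldNormedType.Exports.
Local Open Scope ring_scope.

(** Split a vector as (x, y) along the two parts, with coordinate sums Sx and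
    Sy. The quadratic form of Phi_t is
      (1 - t^2) (|x|^2 + |y|^2) + t^2 (Sx^2 + Sy^2) + 2 t Sx Sy,
    and by Cauchy-Schwarz it is minimal, for given sums, on vectors that are
    constant on each part. Positivity thus reduces to that of a 2 x 2 form, whose
    determinant has the sign of (1 - t^2) (1 - (n - 1) (m - 1) t^2). *)

Definition sum_row (R : pzRingType) (n : nat) (x : 'rV[R]_n) : R :=
  \sum_i x 0 i.
Arguments sum_row {R n} x.

Lemma mul_row_const_mx (R : comPzRingType) (n p : nat) (x : 'rV[R]_n) (c : R) :
  x *m (const_mx c : 'M[R]_(n, p)) = const_mx (c * sum_row x).
Proof.
apply/matrixP => i j; rewrite ord1 !mxE mulr_sumr.
by apply: eq_bigr => k _; rewrite mxE mulrC.
Qed.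

Lemma mul_const_mx_tr (R : comPzRingType) (n p : nat) (x : 'rV[R]_n) (c : R) :
  (const_mx c : 'M[R]_(p, n)) *m x^T = const_mx (c * sum_row x).
Proof.
by rewrite -[LHS]trmxK trmx_mul trmxK trmx_const mul_row_const_mx trmx_const.
Qed.

Lemma sum_row_const (R : pzRingType) (n : nat) (c : R) :
  sum_row (const_mx c : 'rV[R]_n) = c * n%:R.
Proof.
rewrite /sum_row (eq_bigr (fun=> c)) => [|i _]; last by rewrite mxE.
by rewrite sumr_const card_ord mulr_natr.
Qed.

(** Cauchy-Schwarz against the all-ones vector, read off from the nonnegative sum of the squares
    [(N * x 0 i - S) ^+ 2]; equality holds for constant [x]. *)
Lemma sqr_sum_row_le (R : realFieldType) (n : nat) (x : 'rV[R]_n) :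
  (sum_row x) ^+ 2 <= n%:R * (x *m x^T) 0 0.
Proof.
case: n x => [|n] x; first by rewrite /sum_row big_ord0 mul0r expr0n.
set S := sum_row _; set N := (n.+1)%:R : R.
have N0 : 0 < N by rewrite ltr0n.
have : 0 <= \sum_i (N * x 0 i - S) ^+ 2 by apply: sumr_ge0 => i _; exact: sqr_ge0.
have -> : \sum_i (N * x 0 i - S) ^+ 2 = N * (N * (x *m x^T) 0 0 - S ^+ 2).
  transitivity (\sum_i (N ^+ 2 * (x 0 i * x^T i 0) - (2 * N * S) * x 0 i + S ^+ 2)).
    by apply: eq_bigr => i _; rewrite !mxE; ring.
  rewrite big_split sumrB /= -!mulr_sumr sumr_const card_ord -mulr_natl -/N mxE.
  by rewrite -/(sum_row _) -/S; ring.
by rewrite pmulr_rge0 // subr_ge0.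
Qed.

(** For [t > 0] this is the power law for [expR]. At [t = 0] the limit is the value at 0 of the
    continuous function [s ^+ d], where [0 ^+ 0 = 1] produces the identity matrix. *)
Lemma freeness_at_K (R : realType) (n m : nat) (t : R) : 0 <= t ->
  freeness_at (K_freeness R n m) t = \matrix_(i, j) t ^+ K_dist i j.
Proof.
have pow (s : R) (d : nat) : 0 < s -> expR (- d%:R) `^ (- ln s) = s ^+ d.
  move=> s0; rewrite /powR gt_eqF ?expR_gt0// expRK mulrNN mulrC expRM_natl.
  by rewrite lnK.
rewrite /freeness_at le_eqVlt => /predU1P[<-|t0].
  rewrite eqxx; apply/matrixP => i j; rewrite !mxE.
  apply: cvg_lim => //.
  apply: (@cvg_trans _ (@GRing.exp R ^~ (K_dist i j) s @[s --> 0^'+])%classic).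
    apply: near_eq_cvg; near=> s; rewrite pow//.
  by apply: cvg_at_right_filter; exact: exprn_continuous.
rewrite gt_eqF//; apply/matrixP => i j; rewrite !mxE; exact: pow.
Unshelve. all: by end_near.
Qed.

(** Distinct points of one part are at distance 2; the scalar term [1 - t ^+ 2] raises the diagonal
    from [t ^+ 2] to 1. *)
Lemma K_power_block (R : realType) (n m : nat) (t : R) :
  (\matrix_(i, j) t ^+ @K_dist n m i j : 'M[R]_(n + m)) =
  block_mx ((1 - t ^+ 2)%:M + const_mx (t ^+ 2)) (const_mx t)
           (const_mx t) ((1 - t ^+ 2)%:M + const_mx (t ^+ 2)).
Proof.
apply/matrixP => i j; rewrite mxE /K_dist /K_edge.
case: (split_ordP i) => {}i ->; case: (split_ordP j) => {}j ->;
  rewrite ?block_mxEul ?block_mxEur ?block_mxEdl ?block_mxEdr !mxE.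
- rewrite eq_lshift.
  by case: eqP => _ /=; rewrite ?mulr1n ?mulr0n ?subrK ?add0r.
- by rewrite eq_lrshift.
- by rewrite eq_rlshift.
- rewrite eq_rshift.
  by case: eqP => _ /=; rewrite ?mulr1n ?mulr0n ?subrK ?add0r.
Qed.

Lemma K_quadratic_form (R : realType) (n m : nat) (t : R)
    (x : 'rV[R]_n) (y : 'rV[R]_m) : 0 <= t ->
  let v := row_mx x y in
  (v *m freeness_at (K_freeness R n m) t *m v^T) 0 0 =
    (1 - t ^+ 2) * ((x *m x^T) 0 0 + (y *m y^T) 0 0)
    + t ^+ 2 * (sum_row x ^+ 2 + sum_row y ^+ 2)
    + 2 * t * sum_row x * sum_row y.
Proof.
move=> t0 /=; rewrite freeness_at_K// K_power_block mul_row_block tr_row_mx.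
rewrite mul_row_col !mulmxDr !mul_mx_scalar !mul_row_const_mx.
rewrite !mulmxDl -!scalemxAl !mul_const_mx_tr.
move: (x *m x^T) (y *m y^T) => X Y; rewrite !mxE; ring.
Qed.

Lemma psdmx_K (R : realType) (n m : nat) (t : R) :
    (0 < n)%N -> (0 < m)%N -> 0 <= t <= 1 ->
    (m%:R - 1) * (n%:R - 1) * t ^+ 2 <= 1 ->
  psdmx (freeness_at (K_freeness R n m) t).
Proof.
move=> n0 m0 /andP[t0 t1] ht; split.
  rewrite freeness_at_K//; apply/matrixP => i j; rewrite !mxE.
  by rewrite /K_dist /K_edge (eq_sym j i) (eq_sym (j < n)%N).
move=> v; rewrite -[v]hsubmxK K_quadratic_form//.
have := sqr_sum_row_le _ _ (lsubmx v); have := sqr_sum_row_le _ _ (rsubmx v).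
move: (sum_row _) (sum_row _) (_ 0 0) (_ 0 0) => S T X Y hX hY.
have {n0} N1 : 1 <= n%:R :> R by rewrite ler1n.
have {m0} M1 : 1 <= m%:R :> R by rewrite ler1n.
move: (n%:R : R) (m%:R : R) N1 M1 ht hX hY => N M N1 M1 ht hX hY.
have u0 : 0 <= t ^+ 2 by exact: sqr_ge0.
have u1 : t ^+ 2 <= 1 by rewrite expr_le1.
(* On vectors constant on each part the form is [p / N * S ^+ 2 + q / M * T ^+ 2 + 2 * t * S *
   T]. *)
pose p := 1 + (N - 1) * t ^+ 2; pose q := 1 + (M - 1) * t ^+ 2.
have p0 : 0 < p by rewrite ltr_pwDl// mulr_ge0// subr_ge0.
(* Completing the square requires scaling the form by p n m. *)
have MN0 : 0 < p * (N * M) by rewrite mulr_gt0// mulr_gt0//; lra.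
rewrite -(pmulr_rge0 _ MN0).
have det : 0 <= p * q - N * M * t ^+ 2.
  have -> : p * q - N * M * t ^+ 2 =
      (1 - t ^+ 2) * (1 - (M - 1) * (N - 1) * t ^+ 2) by rewrite /p /q; ring.
  by rewrite mulr_ge0// subr_ge0.
(* The first summand collects the Cauchy-Schwarz defects of both parts; the second is the reduced
   form in [S] and [T], with its square completed. *)
have -> : p * (N * M) * ((1 - t ^+ 2) * (X + Y) + t ^+ 2 * (S ^+ 2 + T ^+ 2)
      + 2 * t * S * T) =
    p * (1 - t ^+ 2) * (M * (N * X - S ^+ 2) + N * (M * Y - T ^+ 2))
    + (M * (p * S + t * N * T) ^+ 2 + N * T ^+ 2 * (p * q - N * M * t ^+ 2)).
  by rewrite /p /q; ring.
rewrite addr_ge0//.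
  by apply: mulr_ge0; [apply: mulr_ge0 | apply: addr_ge0; apply: mulr_ge0]; lra.
have M0 : 0 <= M by lra.
have N0 : 0 <= N by lra.
apply: addr_ge0; apply: mulr_ge0 => //; first exact: sqr_ge0.
by apply: mulr_ge0 => //; exact: sqr_ge0.
Qed.

Lemma K_not_psdmx (R : realType) (n m : nat) (t : R) :
    (0 < n)%N -> (0 < m)%N -> 0 < t < 1 ->
    1 < (m%:R - 1) * (n%:R - 1) * t ^+ 2 ->
  ~ psdmx (freeness_at (K_freeness R n m) t).
Proof.
move=> n0 m0 /andP[t0 t1] ht [_].
(* The kernel direction of the first row of the reduced 2 x 2 form. *)
pose p : R := 1 + (n%:R - 1) * t ^+ 2.
move=> /(_ (row_mx (const_mx (- (t * m%:R))) (const_mx p))).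
apply/negP; rewrite -ltNge K_quadratic_form ?ltW//.
rewrite !trmx_const !mul_row_const_mx !sum_row_const ![const_mx _ _ _]mxE.
have {n0} N1 : 1 <= n%:R :> R by rewrite ler1n.
have {m0} M1 : 1 <= m%:R :> R by rewrite ler1n.
move: (n%:R : R) (m%:R : R) @p N1 M1 ht => N M p N1 M1 ht.
have u1 : 0 < 1 - t ^+ 2 by rewrite subr_gt0 expr_lt1// ltW.
have p0 : 0 < p by rewrite ltr_pwDl// mulr_ge0 ?sqr_ge0// subr_ge0.
set f := (X in X < 0).
have -> : f = M * p * ((1 - t ^+ 2) * (1 - (M - 1) * (N - 1) * t ^+ 2)).
  by rewrite /f /p; ring.
rewrite pmulr_rlt0 ?pmulr_rlt0 ?subr_lt0// mulr_gt0//; lra.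
Qed.

(** Turns the threshold into the polynomial condition on [t]. Positivity of [a] matters: the
    convention [0^-1 = 0] would break the equivalence at [a = 0]. *)
Lemma invr_sqrt_le (R : rcfType) (a t : R) : 0 < a -> 0 <= t ->
  (t <= (Num.sqrt a)^-1) = (a * t ^+ 2 <= 1).
Proof.
move=> a0 t0; have s0 : 0 < Num.sqrt a by rewrite sqrtr_gt0.
have -> : a * t ^+ 2 = (t * Num.sqrt a) ^+ 2 by rewrite exprMn mulrC sqr_sqrtr// ltW.
by rewrite expr_le1 ?(mulr_ge0 t0 (ltW s0))// -ler_pdivlMr// mul1r.
Qed.

(* When (m - 1)(n - 1) = 0, the expression 1 / sqrt ((m - 1)(n - 1)) is +oo; as
   the index is by definition in [0, 1], it is then capped to 1. *)
Theorem theorem4p2 (R : realType) (n m : nat) (hn : (1 <= n)%N) (hm : (1 <= m)%N) :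
  [/\ (2 <= n)%N -> (2 <= m)%N ->
        is_MT_index (K_freeness R n m)
          (Num.sqrt ((m%:R - 1) * (n%:R - 1)))^-1,
      n = 1%N \/ m = 1%N -> is_MT_index (K_freeness R n m) 1 &
      (2 <= n)%N -> (2 <= m)%N -> (5 <= n + m)%N ->
        ~ MT_stable (K_freeness R n m)].
Proof.
set a := _ * _; set s := (Num.sqrt a)^-1.
have not_psd t : (2 <= n)%N -> (2 <= m)%N -> s < t -> t < 1 ->
    ~ psdmx (freeness_at (K_freeness R n m) t).
  move=> n2 m2 st t1; have a0 : 0 < a by rewrite mulr_gt0// subr_gt0 ltr1n.
  have t0 : 0 < t by apply: le_lt_trans st; rewrite invr_ge0 sqrtr_ge0.
  apply: K_not_psdmx => //; first by rewrite t0.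
  by rewrite -/a ltNge -invr_sqrt_le// -?ltNge// ltW.
split=> [n2 m2|nm1|n2 m2 nm5].
- have a1 : 1 <= a by rewrite mulr_ege1// lerBrDr -(natrD _ 1 1) ler_nat.
  have a0 : 0 < a by exact: lt_le_trans a1.
  have s0 : 0 <= s by rewrite invr_ge0 sqrtr_ge0.
  have s1 : s <= 1.
    by rewrite invf_le1 ?sqrtr_gt0// -sqrtr1 ler_sqrt// (ltW a0).
  split; first split; first by rewrite s0 s1.
    move=> t /andP[t0 ts]; apply: psdmx_K => //.
      by rewrite t0 (le_trans ts s1).
    by rewrite -/a -invr_sqrt_le.
  move=> t [/andP[t0 t1] psd_t]; rewrite leNgt; apply/negP => st.
  (* The midpoint stays below 1 even if [t = 1], where the form is the square of the total sum and
     hence nonnegative. *)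
  by apply: (not_psd ((s + t) / 2)) => //; [lra|lra|apply: psd_t; lra].
- split=> [|t [/andP[]]//]; split=> [|t t01]; first by rewrite ler01 lexx.
  (* A part with a single point makes the product vanish, so the bound holds for every [t]. *)
  apply: psdmx_K => //; case: nm1 => ->;
  by rewrite subrr ?mulr0 !mul0r ler01.
(* Excluding [n = m = 2] makes one factor of [a] at least 2, which leaves room for a parameter
   strictly between [s] and 1. *)
- have a1 : 1 < a.
    have N2 : 2 <= n%:R :> R by rewrite ler_nat.
    have M2 : 2 <= m%:R :> R by rewrite ler_nat.
    have NM5 : 5 <= n%:R + m%:R :> R by rewrite -natrD ler_nat.
    by rewrite /a; nra.
  have s1 : s < 1.
    by rewrite ltNge invr_sqrt_le ?(lt_trans ltr01 a1)// expr1n mulr1 -ltNge.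
  have s0 : 0 <= s by rewrite invr_ge0 sqrtr_ge0.
  by move=> stable; apply: (not_psd ((s + 1) / 2)) => //; [lra|lra|apply: stable; lra].
Qed.
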